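(* Let $S$ be a semigroup with presentation $\langle X\mid R\rangle$, equipped with a transitive right action by partial functions on a non-empty set $V$ satisfying the stabilizer condition. Then the action complex $K(V)$ is simply connected. Consequently, if $G\le \mathrm{Aut}_S(V)$, then $G\cong\pi_1(K(G\backslash V))$.
   Context: A right action of $S$ on a non-empty set $V$ by partial functions is a homomorphism from $S$ to the semigroup of partial transformations of $V$ (acting on the right), written $v\mapsto vs$. The action is transitive if $vS^1=V$ for all $v\in V$, where $S^1$ is $S$ with an identity adjoined (acting as the identity map). $\mathrm{Aut}_S(V)$ is the group of bijections $g\colon V\to V$ with $(gv)s=g(vs)$ for all $v\in V,s\in S$, where equality means both sides are defined and agree or neither is defined. Stabilizer condition: there is $v\in V$ such that $\mathrm{St}(v)=\{s\in S\mid vs=v\}$ admits no non-trivial homomorphism into a group, where a homomorphism is trivial if its image has cardinality at most $1$ (so the condition holds if $\mathrm{St}(v)$ is empty). For $w\in X^+$ (the free semigroup on $X$), $[w]_S$ denotes its image in $S$. The action complex $K(V)$ (depending on the presentation) is the following $2$-complex. Its vertex set is $V$. Its edges are the pairs $(v,x)\in V\times X$ with $vx$ defined; $(v,x)$ is directed from $v$ to $vx$. Its $2$-cells are the pairs $(p,u=v)$ with $u=v$ a relation in $R$ and $p\in V$ such that $q=p[u]_S=p[v]_S$ is defined; this $2$-cell is a disk whose boundary is attached along the directed path from $p$ to $q$ labeled by $u$ followed by the reverse of the directed path from $p$ to $q$ labeled by $v$. For $G\le\mathrm{Aut}_S(V)$, the orbit set $G\backslash V$ carries the induced transitive action of $S$: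 $(Gv)s=G(vs)$ if $vs$ is defined, and undefined otherwise; $K(G\backslash V)$ is the action complex of this action with respect to the same presentation (it is connected, so the base point of $\pi_1$ is immaterial). *)

(* Defs.v *)
From HB Require Import structures.
From mathcomp Require Import all_boot boolp.

Set Implicit Arguments.
Unset Strict Implicit.
Unset Printing Implicit Defensive.

Local Open Scope group_scope.
Local Open Scope quotient_scope.

Definition isomorphic (G H : groupType) : Prop :=
  exists f : {multiplicative G -> H}, bijective f.

Section SubgroupOf.
Variables (gT : groupType) (G : groupClosed gT).

Definition subgroup_of : Type := {g : gT | g \in (G : {pred gT})}.

HB.instance Definition _ := SubChoice.on subgroup_of.

Fact subgroup_of_closed : group_closed (fun g : gT => g \in (G : {pred gT})).
Proof. by split=> [|g h Gg Gh]; [exact: gpred1 | exact: gpredF]. Qed.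

HB.instance Definition _ :=
  SubChoice_isSubGroup.Build gT _ subgroup_of subgroup_of_closed.

End SubgroupOf.

(** The pair [(x, s)] stands for the non-empty word [x :: s]. *)
Definition word (X : Type) : Type := (X * seq X)%type.

HB.instance Definition _ (X : choiceType) := Choice.copy (word X) (X * seq X)%type.

Definition letters (X : Type) (w : word X) : seq X := w.1 :: w.2.

Definition word_mul (X : Type) (u v : word X) : word X :=
  (u.1, u.2 ++ letters v).

Fact word_mulA (X : choiceType) : associative (@word_mul X).
Proof. by case=> [x s] [y t] [z r]; rewrite /word_mul /= -catA. Qed.

HB.instance Definition _ (X : choiceType) :=
  isSemigroup.Build (word X) (@word_mulA X).

Definition eval (S : semigroupType) (X : Type) (gen : X -> S) (w : word X) : S :=
  foldl (fun s x => s * gen x) (gen w.1) w.2.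

Lemma evalM (S : semigroupType) (X : choiceType) (gen : X -> S) :
  {morph eval gen : u v / u * v}.
Proof.
case=> x s [y t]; rewrite /eval /= foldl_cat /=.
elim/last_ind: t => [|t z IH] //=.
by rewrite -!cats1 !foldl_cat /= IH mulgA.
Qed.

Inductive congruence_gen (T : semigroupType) (R : T -> T -> Prop) :
    T -> T -> Prop :=
  | cong_base u v : R u v -> congruence_gen R u v
  | cong_refl u : congruence_gen R u u
  | cong_sym u v : congruence_gen R u v -> congruence_gen R v u
  | cong_trans u v w :
      congruence_gen R u v -> congruence_gen R v w -> congruence_gen R u w
  | cong_mull w u v : congruence_gen R u v -> congruence_gen R (w * u) (w * v)
  | cong_mulr w u v : congruence_gen R u v -> congruence_gen R (u * w) (v * w).

(** [S] is the quotient of the free semigroup on [X] by the congruence generated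
    by [R], the quotient map being induced by [gen]. *)
Definition presents (S : semigroupType) (X : choiceType) (gen : X -> S)
    (R : word X -> word X -> Prop) : Prop :=
  (forall s, exists w, eval gen w = s) /\
  (forall u v, eval gen u = eval gen v <-> congruence_gen R u v).

(** [act v s = None] means that [vs] is undefined. *)
Record paction (S : semigroupType) (V : Type) := PAction {
  act :> V -> S -> option V;
  actM : forall v s t, act v (s * t) = obind (act^~ t) (act v s)
}.

Section Actions.
Variables (S : semigroupType) (V : choiceType) (a : paction S V).

Definition transitive_action : Prop :=
  forall v w : V, w = v \/ exists s, a v s = Some w.

Definition stabilizer (v : V) : Type := {s : S | a v s == Some v}.

HB.instance Definition _ v := SubChoice.on (stabilizer v).

Fact stabilizer_closed v : mulg_closed (fun s : S => a v s == Some v).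
Proof. by move=> s t /eqP vs /eqP vt; rewrite unfold_in actM vs /= vt. Qed.

HB.instance Definition _ v :=
  SubChoice_isSubSemigroup.Build S _ (stabilizer v) (@stabilizer_closed v).

Definition stabilizer_condition : Prop :=
  exists v : V, forall (H : groupType) (f : {multiplicative stabilizer v -> H})
    (s t : stabilizer v), f s = f t.

Definition is_automorphism (g : V -> V) : Prop :=
  bijective g /\ forall v s, a (g v) s = omap g (a v s).

Record Aut := MkAut {
  aut_fun :> V -> V;
  autP : `[< is_automorphism aut_fun >]
}.

HB.instance Definition _ := [isSub for aut_fun].
HB.instance Definition _ := [Choice of Aut by <:].

Fact aut_one_subproof : `[< is_automorphism id >].
Proof.
by apply/asboolP; split=> [|v s]; [exists id | case: (a v s)].
Qed.

Definition aut_one : Aut := MkAut aut_one_subproof.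

Fact aut_mul_subproof (g h : Aut) : `[< is_automorphism (g \o h) >].
Proof.
case: g h => g /= /asboolP [gb ga] [h /= /asboolP [hb ha]].
apply/asboolP; split=> [|v s /=]; first exact: bij_comp.
by rewrite ga ha; case: (a v s).
Qed.

Definition aut_mul (g h : Aut) : Aut := MkAut (aut_mul_subproof g h).

Lemma aut_bij (g : Aut) : bijective g.
Proof. by case: g => g /= /asboolP []. Qed.

Lemma aut_act (g : Aut) v s : a (g v) s = omap g (a v s).
Proof. by case: g => g /= /asboolP []. Qed.

Fact aut_inv_ex (g : Aut) : exists h : Aut, cancel g h /\ cancel h g.
Proof.
have [h gK hK] := aut_bij g.
have hP : `[< is_automorphism h >].
  apply/asboolP; split=> [|v s]; first by exists g.
  rewrite -{2}(hK v) aut_act.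
  by case: (a (h v) s) => //= w; rewrite gK.
by exists (MkAut hP).
Qed.

Definition aut_inv (g : Aut) : Aut := projT1 (cid (aut_inv_ex g)).

Lemma aut_eqP (g h : Aut) : g =1 h -> g = h.
Proof. by move=> gh; apply: val_inj; apply: funext. Qed.

Fact aut_mulA : associative aut_mul.
Proof. by move=> f g h; apply: aut_eqP. Qed.
Fact aut_mul1g : left_id aut_one aut_mul.
Proof. by move=> g; apply: aut_eqP. Qed.
Fact aut_mulg1 : right_id aut_one aut_mul.
Proof. by move=> g; apply: aut_eqP. Qed.
Fact aut_mulVg : left_inverse aut_one aut_inv aut_mul.
Proof.
by move=> g; apply: aut_eqP => v /=; rewrite /aut_inv; case: cid => h /= [].
Qed.
Fact aut_mulgV : right_inverse aut_one aut_inv aut_mul.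
Proof.
by move=> g; apply: aut_eqP => v /=; rewrite /aut_inv; case: cid => h /= [].
Qed.

HB.instance Definition _ :=
  isGroup.Build Aut aut_mulA aut_mul1g aut_mulg1 aut_mulVg aut_mulgV.

End Actions.

Section OrbitAction.
Variables (S : semigroupType) (V : choiceType) (a : paction S V).
Variable G : groupClosed (Aut a).

Definition same_orbit (v w : V) : bool :=
  `[< exists2 g : Aut a, g \in (G : {pred Aut a}) & w = g v >].

Fact same_orbit_refl : reflexive same_orbit.
Proof. by move=> v; apply/asboolP; exists 1 => //; exact: gpred1. Qed.

Fact same_orbit_sym : symmetric same_orbit.
Proof.
suff H v w : same_orbit v w -> same_orbit w v by move=> v w; apply/idP/idP => /H.
move=> /asboolP [g Gg ->]; apply/asboolP; exists g^-1; first by rewrite gpredV.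
exact: (congr1 (fun h : Aut a => h v) (esym (mulVg g))).
Qed.

Fact same_orbit_trans : transitive same_orbit.
Proof.
move=> v u w /asboolP [g Gg ->] /asboolP [h Gh ->]; apply/asboolP.
by exists (h * g) => //; exact: gpredM.
Qed.

Canonical same_orbit_equiv :=
  EquivRel same_orbit same_orbit_refl same_orbit_sym same_orbit_trans.

Definition orbits : Type := {eq_quot same_orbit_equiv}.

HB.instance Definition _ := Choice.on orbits.
HB.instance Definition _ := EqQuotient.on orbits.

Definition orbit_of (v : V) : orbits := \pi_orbits v.

Definition orbit_act_fun (o : orbits) (s : S) : option orbits :=
  omap orbit_of (a (repr o) s).

Lemma orbit_act_funE v s : orbit_act_fun (orbit_of v) s = omap orbit_of (a v s).
Proof.
have : same_orbit v (repr (orbit_of v)).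
  have := reprK (orbit_of v).
  rewrite {2}/orbit_of => /eqmodP /= H.
  by rewrite same_orbit_sym.
move=> /asboolP [g Gg gv].
rewrite /orbit_act_fun gv aut_act.
case: (a v s) => //= w; congr Some; apply/esym/eqmodP => /=.
by apply/asboolP; exists g.
Qed.

Fact orbit_actM o s t :
  orbit_act_fun o (s * t) = obind (orbit_act_fun^~ t) (orbit_act_fun o s).
Proof.
rewrite -[o]reprK -/(orbit_of (repr o)) !orbit_act_funE actM.
by case: (a (repr o) s) => //= w; rewrite orbit_act_funE.
Qed.

Definition orbit_action : paction S orbits := PAction orbit_actM.

End OrbitAction.

(** A dart is an edge with a direction of travel: [(e, true)] runs from the
    source of [e] to its target and [(e, false)] runs backwards. *)
Section EdgePaths.
Variables (T E : choiceType) (src tgt : E -> T).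

Definition dart_src (d : E * bool) : T := if d.2 then src d.1 else tgt d.1.
Definition dart_tgt (d : E * bool) : T := if d.2 then tgt d.1 else src d.1.

Fixpoint edge_path (v : T) (p : seq (E * bool)) (w : T) : bool :=
  if p is d :: p' then (dart_src d == v) && edge_path (dart_tgt d) p' w
  else v == w.

End EdgePaths.

Definition dart_inv (E : Type) (d : E * bool) : E * bool := (d.1, ~~ d.2).

Definition path_inv (E : Type) (p : seq (E * bool)) : seq (E * bool) :=
  rev (map (@dart_inv E) p).

(** Combinatorial 2-complexes: a 2-cell [c] is a disk attached along the closed
    edge path [boundary c]. Their fundamental groups are edge-path groups. *)
Record complex2 := Complex2 {
  vertex : choiceType;
  edge : choiceType;
  source : edge -> vertex;
  target : edge -> vertex;
  cell : Type;
  base : cell -> vertex;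
  boundary : cell -> seq (edge * bool);
  boundaryP : forall c, edge_path source target (base c) (boundary c) (base c)
}.

Section FundamentalGroup.
Variable K : complex2.

Implicit Types (v w : vertex K) (p q : seq (edge K * bool)).

Definition is_path v p w : bool := edge_path (@source K) (@target K) v p w.

(** Homotopy of edge paths from [v] to [w]: one may insert or delete a
    backtracking [d d^-1] or the boundary of a 2-cell. *)
Inductive homotopic v w : seq (edge K * bool) -> seq (edge K * bool) -> Prop :=
  | homotopic_refl p : is_path v p w -> homotopic v w p p
  | homotopic_sym p q : homotopic v w p q -> homotopic v w q p
  | homotopic_trans p q r :
      homotopic v w p q -> homotopic v w q r -> homotopic v w p r
  | homotopic_backtrack p q d :
      is_path v (p ++ [:: d; dart_inv d] ++ q) w ->
      homotopic v w (p ++ [:: d; dart_inv d] ++ q) (p ++ q)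
  | homotopic_cell p q (c : cell K) :
      is_path v (p ++ boundary c ++ q) w ->
      homotopic v w (p ++ boundary c ++ q) (p ++ q).

Lemma is_path_cat u v w p q :
  is_path u p v -> is_path v q w -> is_path u (p ++ q) w.
Proof.
rewrite /is_path; elim: p u => [|d p IH] u /= => [/eqP -> //|].
by case/andP=> -> /= /IH; apply.
Qed.

Lemma dart_srcV d :
  dart_src (@source K) (@target K) (dart_inv d) = dart_tgt (@source K) (@target K) d.
Proof. by case: d => e []. Qed.

Lemma dart_tgtV d :
  dart_tgt (@source K) (@target K) (dart_inv d) = dart_src (@source K) (@target K) d.
Proof. by case: d => e []. Qed.

Lemma is_path_inv v w p : is_path v p w -> is_path w (path_inv p) v.
Proof.
rewrite /is_path /path_inv; elim: p v => [|d p IH] v /= => [|/andP[/eqP <- /IH H]].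
  by rewrite eq_sym.
rewrite rev_cons -cats1; apply: is_path_cat H _.
by rewrite /is_path /= dart_srcV dart_tgtV !eqxx.
Qed.

Lemma homotopic_cat u v w p p' q q' :
  homotopic u v p p' -> homotopic v w q q' ->
  homotopic u w (p ++ q) (p' ++ q').
Proof.
have isp x y r r' : homotopic x y r r' -> is_path x r y /\ is_path x r' y.
  have catP r1 r2 z t : is_path z (r1 ++ r2) t ->
      exists2 m, is_path z r1 m & is_path m r2 t.
    rewrite /is_path; elim: r1 z => [|d r1 IH] z /=; first by exists z.
    by case/andP=> dz /IH [m H1 H2]; exists m => //; rewrite dz.
  have loopP r1 r2 r3 : (exists m, is_path m r2 m) ->
      is_path x (r1 ++ r2 ++ r3) y -> is_path x (r1 ++ r3) y.
    move=> [m mm] /catP [m1 H1] /catP [m2 H2 H3].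
    apply: (is_path_cat H1); case: r2 mm H2 => [|d r2] /= mm.
      by rewrite /is_path /= => /eqP ->.
    rewrite /is_path /= => /andP [/eqP dm1 H2].
    move: mm; rewrite /is_path /= dm1 => /andP [/eqP m1m H].
    have tgt_uniq (z t t' : vertex K) r0 : is_path z r0 t -> is_path z r0 t' -> t = t'.
      rewrite /is_path; elim: r0 z => [|d0 r0 IH] z /= => [/eqP <- /eqP //|].
      by case/andP=> _ /IH {}IH /andP [_ /IH].
    by rewrite m1m (tgt_uniq _ _ _ _ H H2).
  elim=> [{}r H|{}r {}r' _ []|r1 r2 r3 _ [? ?] _ [? ?]|r1 r2 d H|r1 r2 c H] //;
    split=> //; apply: loopP H.
    exists (dart_src (@source K) (@target K) d).
    by rewrite /is_path /= dart_srcV dart_tgtV !eqxx.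
  by exists (base c); exact: boundaryP.
move=> Hp Hq; apply: (@homotopic_trans _ _ _ (p' ++ q)).
  have [Hq1 _] := isp _ _ _ _ Hq.
  elim: Hp => [r H|r r' _ H|r1 r2 r3 _ H _ H'|r1 r2 d H|r1 r2 c H].
  - exact: homotopic_refl (is_path_cat H Hq1).
  - exact: homotopic_sym.
  - exact: homotopic_trans H H'.
  - rewrite -!catA; apply: homotopic_backtrack.
    by have := is_path_cat H Hq1; rewrite -!catA.
  - rewrite -!catA; apply: homotopic_cell.
    by have := is_path_cat H Hq1; rewrite -!catA.
have [_ Hp1] := isp _ _ _ _ Hp.
elim: Hq => [r H|r r' _ H|r1 r2 r3 _ H _ H'|r1 r2 d H|r1 r2 c H].
- exact: homotopic_refl (is_path_cat Hp1 H).
- exact: homotopic_sym.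
- exact: homotopic_trans H H'.
- rewrite !(catA p'); apply: homotopic_backtrack.
  by have := is_path_cat Hp1 H; rewrite -!catA.
- rewrite !(catA p'); apply: homotopic_cell.
  by have := is_path_cat Hp1 H; rewrite -!catA.
Qed.

Lemma homotopic_invr v w p : is_path v p w -> homotopic v v (p ++ path_inv p) [::].
Proof.
rewrite /is_path; elim: p v => [|d p IH] v.
  by move=> _; apply: homotopic_refl; rewrite /is_path /=.
move=> /= /andP [/eqP dv H].
have Pd : is_path v [:: d] (dart_tgt (@source K) (@target K) d).
  by rewrite /is_path /= dv !eqxx.
have Pd' := is_path_inv Pd.
have E : path_inv (d :: p) = path_inv p ++ path_inv [:: d].
  by rewrite /path_inv /= rev_cons -cats1.
have -> : d :: p ++ path_inv (d :: p) =
    [:: d] ++ (p ++ path_inv p) ++ path_inv [:: d] by rewrite E /= catA.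
apply: (@homotopic_trans _ _ _ ([:: d] ++ [::] ++ path_inv [:: d])).
  apply: (homotopic_cat (homotopic_refl Pd)).
  exact: (homotopic_cat (IH _ H) (homotopic_refl Pd')).
apply: (@homotopic_backtrack v v [::] [::] d).
exact: (is_path_cat Pd Pd').
Qed.

Lemma path_invK p : path_inv (path_inv p) = p.
Proof.
rewrite /path_inv map_rev revK -map_comp -[RHS]map_id.
by apply: eq_map => -[e b]; rewrite /= /dart_inv /= negbK.
Qed.

Lemma homotopic_invl v w p : is_path v p w -> homotopic w w (path_inv p ++ p) [::].
Proof. by move=> /is_path_inv /homotopic_invr; rewrite path_invK. Qed.

Lemma homotopic_path_inv v w p q :
  is_path v p w -> is_path v q w ->
  homotopic v w p q -> homotopic w v (path_inv p) (path_inv q).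
Proof.
move=> Hp Hq H; have Hp' := is_path_inv Hp; have Hq' := is_path_inv Hq.
apply: (@homotopic_trans _ _ _ (path_inv p ++ (q ++ path_inv q))).
  rewrite -{1}[path_inv p]cats0; apply: (homotopic_cat (homotopic_refl Hp')).
  exact/homotopic_sym/(homotopic_invr Hq).
rewrite catA -{2}[path_inv q]cat0s.
apply: homotopic_cat _ (homotopic_refl Hq').
apply: homotopic_trans (homotopic_invl Hp).
exact: (homotopic_cat (homotopic_refl Hp') (homotopic_sym H)).
Qed.

Section AtVertex.
Variable b : vertex K.

Definition loop : Type := {p : seq (edge K * bool) | is_path b p b}.

HB.instance Definition _ := SubChoice.on loop.

Definition loop_homotopic (p q : loop) : bool :=
  `[< homotopic b b (val p) (val q) >].

Fact loop_homotopic_refl : reflexive loop_homotopic.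
Proof. by move=> p; apply/asboolP/homotopic_refl; exact: (valP p). Qed.

Fact loop_homotopic_sym : symmetric loop_homotopic.
Proof.
by move=> p q; apply/asboolP/asboolP; exact: homotopic_sym.
Qed.

Fact loop_homotopic_trans : transitive loop_homotopic.
Proof.
by move=> q p r /asboolP H /asboolP H'; apply/asboolP/(homotopic_trans H H').
Qed.

Canonical loop_homotopic_equiv := EquivRel loop_homotopic
  loop_homotopic_refl loop_homotopic_sym loop_homotopic_trans.

Definition pi1 : Type := {eq_quot loop_homotopic_equiv}.

HB.instance Definition _ := Choice.on pi1.
HB.instance Definition _ := EqQuotient.on pi1.

Definition loop_class (p : loop) : pi1 := \pi_pi1 p.

Fact loop_one_subproof : is_path b [::] b.
Proof. by rewrite /is_path /=. Qed.

Definition loop_one : loop := exist _ [::] loop_one_subproof.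
Definition loop_mul (p q : loop) : loop :=
  exist _ (val p ++ val q) (is_path_cat (valP p) (valP q)).
Definition loop_inv (p : loop) : loop :=
  exist _ (path_inv (val p)) (is_path_inv (valP p)).

Definition pi1_one : pi1 := loop_class loop_one.
Definition pi1_mul (x y : pi1) : pi1 := loop_class (loop_mul (repr x) (repr y)).
Definition pi1_inv (x : pi1) : pi1 := loop_class (loop_inv (repr x)).

Lemma loop_classP (p q : loop) :
  loop_class p = loop_class q <-> homotopic b b (val p) (val q).
Proof.
split=> [/eqmodP /= /asboolP //|H].
by apply/eqmodP => /=; apply/asboolP.
Qed.

Lemma repr_loop_class (p : loop) : homotopic b b (val (repr (loop_class p))) (val p).
Proof. by apply/loop_classP; exact: reprK. Qed.

Lemma pi1_mulE (p q : loop) :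
  pi1_mul (loop_class p) (loop_class q) = loop_class (loop_mul p q).
Proof. by apply/loop_classP/homotopic_cat; exact: repr_loop_class. Qed.

Lemma pi1_invE (p : loop) : pi1_inv (loop_class p) = loop_class (loop_inv p).
Proof.
apply/loop_classP/homotopic_path_inv; last exact: repr_loop_class.
- exact: (valP (repr (loop_class p))).
- exact: (valP p).
Qed.

Lemma pi1_ind (P : pi1 -> Prop) : (forall p : loop, P (loop_class p)) -> forall x, P x.
Proof. by move=> H x; rewrite -[x]reprK; exact: H. Qed.

Fact pi1_mulA : associative pi1_mul.
Proof.
elim/pi1_ind=> p; elim/pi1_ind=> q; elim/pi1_ind=> r.
by rewrite !pi1_mulE; congr loop_class; apply: val_inj; rewrite /= catA.
Qed.
Fact pi1_mul1g : left_id pi1_one pi1_mul.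
Proof.
by elim/pi1_ind=> p; rewrite pi1_mulE; congr loop_class; apply: val_inj.
Qed.
Fact pi1_mulg1 : right_id pi1_one pi1_mul.
Proof.
elim/pi1_ind=> p; rewrite pi1_mulE; congr loop_class.
by apply: val_inj; rewrite /= cats0.
Qed.
Fact pi1_mulVg : left_inverse pi1_one pi1_inv pi1_mul.
Proof.
elim/pi1_ind=> p; rewrite pi1_invE pi1_mulE.
exact/loop_classP/(homotopic_invl (valP p)).
Qed.
Fact pi1_mulgV : right_inverse pi1_one pi1_inv pi1_mul.
Proof.
elim/pi1_ind=> p; rewrite pi1_invE pi1_mulE.
exact/loop_classP/(homotopic_invr (valP p)).
Qed.

HB.instance Definition _ :=
  isGroup.Build pi1 pi1_mulA pi1_mul1g pi1_mulg1 pi1_mulVg pi1_mulgV.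

End AtVertex.

Definition connected_complex : Prop :=
  inhabited (vertex K) /\ forall v w, exists p, is_path v p w.

Definition simply_connected : Prop :=
  connected_complex /\ forall (b : vertex K) (x : pi1 b), x = 1.

End FundamentalGroup.

Section ActionComplex.
Variables (S : semigroupType) (X : choiceType) (gen : X -> S).
Variable R : word X -> word X -> Prop.
Variables (V : choiceType) (a : paction S V).

Definition action_edge : Type := {e : V * X | isSome (a e.1 (gen e.2))}.

HB.instance Definition _ := SubChoice.on action_edge.

Definition edge_label (e : action_edge) : X := (val e).2.
Definition edge_source (e : action_edge) : V := (val e).1.

(** The default value is never used, by definition of [action_edge]. *)
Definition edge_target (e : action_edge) : V :=
  odflt (val e).1 (a (val e).1 (gen (val e).2)).

(** The directed path from [v] labelled by [s]; it is cut short at the first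
    undefined step, which does not happen along the boundary of a 2-cell
    (lemma [directed_pathP]). *)
Fixpoint directed_path (v : V) (s : seq X) : seq (action_edge * bool) :=
  if s is x :: s' then
    if (insub (v, x) : option action_edge) is Some e
    then (e, true) :: directed_path (edge_target e) s'
    else [::]
  else [::].

Lemma directed_pathP v w (u : word X) :
  a v (eval gen u) = Some w ->
  edge_path edge_source edge_target v (directed_path v (letters u)) w /\
  map (fun d : action_edge * bool => (edge_label d.1, d.2))
      (directed_path v (letters u)) = map (fun x => (x, true)) (letters u).
Proof.
have step z x z' : a z (gen x) = Some z' -> exists e : action_edge,
    [/\ insub (z, x) = Some e, edge_source e = z, edge_target e = z'
      & edge_label e = x].
  move=> H; have H' : isSome (a (z, x).1 (gen (z, x).2)) by rewrite /= H.
  exists (exist _ (z, x) H').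
  by rewrite insubT /edge_source /edge_target /edge_label /= H.
have evalS x y s : eval gen (x, y :: s) = gen x * eval gen (y, s).
  exact: (evalM gen (x, [::]) (y, s)).
case: u => x s; rewrite /letters /=.
elim: s x v => [|y s IH] x v.
  rewrite /eval /= => /step [e [-> ev ew ex]].
  by rewrite /= /dart_src /dart_tgt /= ev ew ex !eqxx.
rewrite evalS actM; case E: (a v (gen x)) => [z|//] /= /IH [H1 H2].
have [e [-> ev ew ex]] := step _ _ _ E.
rewrite /= ew; split; first by rewrite /dart_src /dart_tgt /= ev ew eqxx.
by rewrite ex; congr cons; exact: H2.
Qed.

(** The 2-cell [(p, u = v)], together with the vertex [q = p[u] = p[v]]. *)
Record action_cell := ActionCell {
  cell_source : V;
  cell_lhs : word X;
  cell_rhs : word X;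
  cell_target : V;
  cell_rel : R cell_lhs cell_rhs;
  cell_lhsP : a cell_source (eval gen cell_lhs) = Some cell_target;
  cell_rhsP : a cell_source (eval gen cell_rhs) = Some cell_target
}.

Definition cell_boundary (c : action_cell) : seq (action_edge * bool) :=
  directed_path (cell_source c) (letters (cell_lhs c)) ++
  path_inv (directed_path (cell_source c) (letters (cell_rhs c))).

Fact cell_boundaryP c : edge_path edge_source edge_target
  (cell_source c) (cell_boundary c) (cell_source c).
Proof.
have [H1 _] := directed_pathP (cell_lhsP c).
have [H2 _] := directed_pathP (cell_rhsP c).
pose K := @Complex2 V action_edge edge_source edge_target False
  (fun x => match x with end) (fun x => match x with end)
  (fun x => match x with end).
exact: (@is_path_cat K _ _ _ _ _ H1 (@is_path_inv K _ _ _ H2)).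
Qed.

Definition action_complex : complex2 :=
  @Complex2 V action_edge edge_source edge_target action_cell
    cell_source cell_boundary cell_boundaryP.

End ActionComplex.

(* Main.v *)
Require Import Defs.
From HB Require Import structures.
From mathcomp Require Import all_boot boolp.

(** Why [K(V)] is simply connected. Sending an element [s] of the stabilizer of
    [v0] to the directed loop at [v0] labelled by a word representing [s] is
    well defined up to homotopy, because the 2-cells of [K(V)] record the
    defining relations of [S] ([path_of_homotopic]). This is a homomorphism
    from the stabilizer to the fundamental group at [v0]; the stabilizer
    condition makes it constant, and a constant homomorphism into a group takes
    the value [1], so every directed loop at [v0] is null-homotopic
    ([directed_loop_null]). By transitivity every directed path out of [v0] can
    be closed up to a directed loop, so two directed paths from [v0] with the
    same end are homotopic ([reads_homotopic]). An edge traversed backwards,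
    appended to a directed path, can then be absorbed: replace the directed
    path by a directed path to the other end of the edge, followed by the edge,
    and cancel. Hence any path, preceded by a directed path from [v0], is
    homotopic to a directed path ([absorb_path]), and a loop is thereby
    null-homotopic.

    Why [G] is the fundamental group of [K(G\V)]. An automorphism of a
    transitive action is determined by one of its values ([aut_free]), so [G]
    acts freely on [V], and this makes the projection from [K(V)] to [K(G\V)] a
    covering ([orbit_covering]): at a given target, an edge of [K(V)] is
    determined by its image, since an element of [G] relating two such edges
    fixes that target. As [K(V)] is simply connected, [G] is the fundamental
    group of the quotient by the usual correspondence, for coverings of
    combinatorial 2-complexes ([deck_group_pi1]): [g] goes to the image of any
    path from [v] to [g v], and lifting loops gives the inverse. *)

Set Implicit Arguments.
Unset Strict Implicit.
Unset Printing Implicit Defensive.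

Local Open Scope group_scope.
Local Open Scope quotient_scope.

Lemma inj_surj_bij (A B : Type) (f : A -> B) :
  injective f -> (forall y, exists x, f x = y) -> bijective f.
Proof.
move=> finj fsurj; exists (fun y => projT1 (cid (fsurj y))) => [x|y].
  by apply: finj; case: cid.
by case: cid.
Qed.

(** * Edge paths and homotopy *)

Section Paths.
Variable K : complex2.
Implicit Types (u v w : vertex K) (p q r : seq (edge K * bool)).

Local Notation src := (dart_src (@source K) (@target K)).
Local Notation tgt := (dart_tgt (@source K) (@target K)).

Lemma is_path_nil v : is_path v [::] v.
Proof. by rewrite /is_path /=. Qed.

Lemma is_path_cons v d p w :
  is_path v (d :: p) w = (src d == v) && is_path (tgt d) p w.
Proof. by []. Qed.

Lemma is_path_dart d : is_path (src d) [:: d] (tgt d).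
Proof. by rewrite /is_path /= !eqxx. Qed.

Lemma is_path_catP u w p q :
  is_path u (p ++ q) w -> exists2 v, is_path u p v & is_path v q w.
Proof.
rewrite /is_path; elim: p u => [|d p IH] u /=; first by exists u.
by case/andP=> du /IH [v pv qv]; exists v => //; rewrite du.
Qed.

Lemma is_path_uniq v p w w' : is_path v p w -> is_path v p w' -> w = w'.
Proof.
rewrite /is_path; elim: p v => [|d p IH] v /= => [/eqP <- /eqP //|].
by case/andP=> _ /IH {}IH /andP [_ /IH].
Qed.

Lemma homotopic_cancell u v w t p q :
  is_path u t v -> is_path v p w -> is_path v q w ->
  homotopic u w (t ++ p) (t ++ q) -> homotopic v w p q.
Proof.
move=> tP pP qP tpq.
have collapse r : is_path v r w -> homotopic v w (path_inv t ++ t ++ r) r.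
  move=> rP; rewrite catA -{2}[r]cat0s.
  exact: homotopic_cat (homotopic_invl tP) (homotopic_refl rP).
apply: homotopic_trans (homotopic_sym (collapse _ pP)) _.
apply: homotopic_trans (collapse _ qP).
exact: homotopic_cat (homotopic_refl (is_path_inv tP)) tpq.
Qed.

Lemma homotopic_cancelr u v w t p q :
  is_path v t w -> is_path u p v -> is_path u q v ->
  homotopic u w (p ++ t) (q ++ t) -> homotopic u v p q.
Proof.
move=> tP pP qP pqt.
have collapse r : is_path u r v -> homotopic u v ((r ++ t) ++ path_inv t) r.
  move=> rP; rewrite -catA -{2}[r]cats0.
  exact: homotopic_cat (homotopic_refl rP) (homotopic_invr tP).
apply: homotopic_trans (homotopic_sym (collapse _ pP)) _.
apply: homotopic_trans (collapse _ qP).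
exact: homotopic_cat pqt (homotopic_refl (is_path_inv tP)).
Qed.

Lemma simply_connected_homotopic v w p q :
  simply_connected K -> is_path v p w -> is_path v q w -> homotopic v w p q.
Proof.
case=> _ trivial_pi1 pP qP.
apply: (homotopic_cancelr (is_path_inv qP) pP qP).
apply: homotopic_trans (homotopic_sym (homotopic_invr qP)).
pose l : loop v := exist _ (p ++ path_inv q) (is_path_cat pP (is_path_inv qP)).
by have /loop_classP := trivial_pi1 v (loop_class l).
Qed.

End Paths.

(** Building the class from the underlying path keeps the proof that it is closed
    as a visible argument, so equations between classes of explicit paths can be
    stated without naming the subtype of loops. *)
Definition path_class (K : complex2) (b : vertex K) p (pP : is_path b p b) : pi1 b :=
  loop_class (exist (fun r => is_path b r b) p pP).

Lemma path_classP (K : complex2) (b : vertex K) p q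
    (pP : is_path b p b) (qP : is_path b q b) :
  path_class pP = path_class qP <-> homotopic b b p q.
Proof. exact: loop_classP. Qed.

Lemma path_classM (K : complex2) (b : vertex K) p q
    (pP : is_path b p b) (qP : is_path b q b) :
  path_class pP * path_class qP = path_class (is_path_cat pP qP).
Proof.
by apply: etrans (pi1_mulE _ _) _; congr loop_class; exact: val_inj.
Qed.

(** * Coverings of 2-complexes *)

Definition map_dart (E F : Type) (f : E -> F) (d : E * bool) : F * bool :=
  (f d.1, d.2).

Record complex_map (K L : complex2) := ComplexMap {
  on_vertex :> vertex K -> vertex L;
  on_edge : edge K -> edge L;
  source_map : forall e, source (on_edge e) = on_vertex (source e);
  target_map : forall e, target (on_edge e) = on_vertex (target e);
  cell_map : forall c : cell K, exists2 c' : cell L,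
    base c' = on_vertex (base c)
    & boundary c' = map (map_dart on_edge) (boundary c)
}.

Section ComplexMaps.
Variables (K L : complex2) (f : complex_map K L).
Implicit Types (u v w : vertex K) (p q : seq (edge K * bool)).

Local Notation fpath := (map (map_dart (on_edge f))).

Lemma dart_src_map d : dart_src (@source L) (@target L) (map_dart (on_edge f) d) =
  f (dart_src (@source K) (@target K) d).
Proof. by case: d => e []; [apply: source_map | apply: target_map]. Qed.

Lemma dart_tgt_map d : dart_tgt (@source L) (@target L) (map_dart (on_edge f) d) =
  f (dart_tgt (@source K) (@target K) d).
Proof. by case: d => e []; [apply: target_map | apply: source_map]. Qed.

Lemma is_path_map v p w : is_path v p w -> is_path (f v) (fpath p) (f w).
Proof.
rewrite /is_path; elim: p v => [|d p IH] v /= => [/eqP -> //|/andP [/eqP <- /IH]].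
by rewrite dart_src_map dart_tgt_map eqxx.
Qed.

Lemma homotopic_map v w p q :
  homotopic v w p q -> homotopic (f v) (f w) (fpath p) (fpath q).
Proof.
elim=> {p q} [p pP|p q _ H|p q r _ H _ H'|p q d H|p q c H].
- exact: homotopic_refl (is_path_map pP).
- exact: homotopic_sym.
- exact: homotopic_trans H H'.
- rewrite !map_cat; apply: (homotopic_backtrack (d := map_dart (on_edge f) d)).
  by have := is_path_map H; rewrite !map_cat.
- have [c' _ Ec'] := cell_map f c.
  rewrite !map_cat -Ec'; apply: homotopic_cell.
  by have := is_path_map H; rewrite !map_cat -Ec'.
Qed.

End ComplexMaps.

Section Coverings.
Variables (K L : complex2) (f : complex_map K L).
Implicit Types (u v w : vertex K) (o : vertex L) (p q : seq (edge L * bool)).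

Local Notation fpath := (map (map_dart (on_edge f))).

(** The two clauses are what a topological covering provides locally: a bijection
    between the darts leaving a vertex and those leaving its image, which takes
    care of both orientations of an edge at once, and, over a disk, a disk
    attached at any chosen point of the fibre. *)
Definition covering : Prop :=
  (forall v d, dart_src (@source L) (@target L) d = f v ->
     exists! d', dart_src (@source K) (@target K) d' = v
       /\ map_dart (on_edge f) d' = d) /\
  (forall v (c : cell L), base c = f v -> exists2 c' : cell K,
     base c' = v & map (map_dart (on_edge f)) (boundary c') = boundary c).

(** For a covering this is the graph of the monodromy: [w] is the end of the lift
    of [p] from [v]. Working with ends, rather than with lifted paths, avoids
    transporting homotopies to [K]. *)
Definition lifts v p w : Prop :=
  exists2 p', is_path v p' w & fpath p' = p.

Lemma lifts_path v (p : seq (edge K * bool)) w : is_path v p w -> lifts v (fpath p) w.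
Proof. by exists p. Qed.

Lemma lifts_catP v p q w :
  lifts v (p ++ q) w <-> exists2 u, lifts v p u & lifts u q w.
Proof.
split=> [[r rP]|[u [p' p'P <-] [q' q'P <-]]]; last first.
  by exists (p' ++ q'); [exact: is_path_cat p'P q'P | rewrite map_cat].
move=> Er.
have Ep : fpath (take (size p) r) = p by rewrite map_take Er take_size_cat.
have Eq : fpath (drop (size p) r) = q by rewrite map_drop Er drop_size_cat.
move: rP; rewrite -(cat_take_drop (size p) r) => /is_path_catP [u H1 H2].
by exists u; [exists (take (size p) r) | exists (drop (size p) r)].
Qed.

Hypothesis fcov : covering.

Lemma lifts_uniq v p w w' : lifts v p w -> lifts v p w' -> w = w'.
Proof.
move=> [p1 p1P <-] [p2 p2P] /esym E; suff E12 : p1 = p2.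
  by rewrite -E12 in p2P; exact: is_path_uniq p1P p2P.
elim: p1 v p2 p1P p2P E => [|d1 p1 IH] v [|d2 p2] //= /andP [/eqP v1 P1].
move=> /andP [/eqP v2 P2] E; have [Ee Eb Ep] : [/\ on_edge f d1.1 = on_edge f d2.1,
  d1.2 = d2.2 & fpath p1 = fpath p2] by case: E.
have Ed : map_dart (on_edge f) d1 = map_dart (on_edge f) d2 by congr pair.
have [d [_ dU]] := fcov.1 v (map_dart (on_edge f) d2)
  (etrans (dart_src_map f d2) (congr1 f v2)).
have E12 : d1 = d2 by rewrite -(dU d1) ?(dU d2).
by rewrite E12; congr cons; apply: IH P1 _ Ep; rewrite E12.
Qed.

Lemma lifts_ex v p o : is_path (f v) p o -> exists2 w, lifts v p w & f w = o.
Proof.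
elim: p v => [|d p IH] v.
  by move=> /eqP <-; exists v => //; exists [::] => //; exact: is_path_nil.
rewrite /is_path /= => /andP [/eqP dv pP].
have [d' [[d'v d'd] _]] := fcov.1 v d dv.
rewrite -d'd dart_tgt_map in pP.
have [w [p' p'P Ep] wo] := IH _ pP.
exists w => //; exists (d' :: p'); last by rewrite /= d'd Ep.
by rewrite /is_path /= d'v eqxx.
Qed.

Lemma lifts_inv v d w : lifts v [:: d] w -> lifts w [:: dart_inv d] v.
Proof.
move=> [[|d' [|//]] // d'P [<-]]; exists [:: dart_inv d'] => //.
exact: (is_path_inv d'P).
Qed.

(** The lift of the boundary of a 2-cell closes up, being the boundary of a lifted
    2-cell. A non-empty boundary starting at [f v] determines the base of the
    cell; an empty one has only the empty lift. *)
Lemma lifts_boundary v (c : cell L) o w :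
  is_path (f v) (boundary c) o -> lifts v (boundary c) w -> w = v.
Proof.
move=> cP cl.
have [Ec|cn] := eqVneq (boundary c) [::].
  by move: cl; rewrite Ec => -[[|//] /eqP].
have Eb : base c = f v.
  move: cP cn (boundaryP c); rewrite /is_path; case: (boundary c) => //= d p.
  by move=> /andP [/eqP <- _] _ /andP [/eqP <- _].
have [c' c'v Ec] := fcov.2 v c Eb.
apply: lifts_uniq cl _; exists (boundary c') => //.
by rewrite -c'v; exact: boundaryP.
Qed.

(** Homotopy lifting. Both elementary moves delete a closed subpath [r] all of
    whose lifts are closed, and deleting such an [r] does not change the end of
    a lift. Stating it as an equivalence makes symmetry and transitivity of
    homotopy immediate. *)
Lemma lifts_homotopic v w o p q :
  homotopic (f v) o p q -> (lifts v p w <-> lifts v q w).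
Proof.
have contract p1 r q1 : is_path (f v) (p1 ++ r ++ q1) o ->
    (forall u z, is_path (f u) r z -> forall u', lifts u r u' -> u' = u) ->
  (lifts v (p1 ++ r ++ q1) w <-> lifts v (p1 ++ q1) w).
  move=> pP rloop.
  have [o1 p1P /is_path_catP [o2 rP q1P]] := is_path_catP pP.
  have [u p1u Eu] := lifts_ex p1P; rewrite -Eu in rP.
  have [u' ru' _] := lifts_ex rP; have Eu' := rloop _ _ rP _ ru'.
  (* This lift of [r] returns to [u], so inserting it in a lift of [p1 ++ q1]
     is possible and harmless. *)
  rewrite {u'}Eu' in ru'.
  split=> /lifts_catP [u1 p1u1].
    rewrite -{u1 p1u1}(lifts_uniq p1u p1u1) => /lifts_catP [u2 ru2].
    by rewrite -(lifts_uniq ru' ru2) => q1w; apply/lifts_catP; exists u.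
  rewrite -{u1 p1u1}(lifts_uniq p1u p1u1) => q1w.
  by apply/lifts_catP; exists u => //; apply/lifts_catP; exists u.
elim=> {p q} [p pP|p q _ H|p q r _ H _ H'|p q d H|p q c H] //.
- by split=> /H.
- by split=> [/H /H'|/H' /H].
- apply: contract H _ => u z _ u' /(@lifts_catP u [:: d]) [u1 du1 du'].
  exact: lifts_uniq du' (lifts_inv du1).
- by apply: contract H _ => u z cP u'; exact: lifts_boundary cP.
Qed.

End Coverings.

Section DeckGroup.
Variables (K L : complex2) (f : complex_map K L).
Variables (G : groupType) (deck : G -> complex_map K K).
Hypothesis Ksc : simply_connected K.
Hypothesis fcov : covering f.
Hypothesis deckM : forall g h v, deck (g * h) v = deck g (deck h v).
Hypothesis deck_over : forall g v, f (deck g v) = f v.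
Hypothesis deck_over_edge : forall g e, on_edge f (on_edge (deck g) e) = on_edge f e.
Hypothesis deck_trans : forall v w, f v = f w -> exists g, w = deck g v.
Hypothesis deck_free : forall g h v, deck g v = deck h v -> g = h.

Local Notation fpath := (map (map_dart (on_edge f))).

(** The group acts simply transitively on the fibre of [v]. A path from [v] to
    [deck g v] is unique up to homotopy, so its image depends only on [g]. For
    products, concatenate a path to [deck g v] with the translate by [g] of a
    path to [deck h v]: a path and its translate have the same image. Homotopy
    lifting recovers [deck g v], hence [g], from the image, and lifting an
    arbitrary loop produces a point of the fibre, hence a [g]. *)
Theorem deck_group_pi1 (v : vertex K) : isomorphic G (pi1 (f v)).
Proof.
have loopP g p : is_path v p (deck g v) -> is_path (f v) (fpath p) (f v).
  by move/(is_path_map f); rewrite deck_over.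
pose path_to g := cid (Ksc.1.2 v (deck g v)).
pose F g : pi1 (f v) := path_class (loopP g _ (projT2 (path_to g))).
have FE g p (pP : is_path v p (deck g v)) :
    F g = path_class (loopP g p pP).
  apply/path_classP; rewrite -{2}(deck_over g v); apply: homotopic_map.
  exact: simply_connected_homotopic (projT2 (path_to g)) pP.
have FM : {morph F : g h / g * h}.
  move=> g h; have pP := projT2 (path_to g); have qP := projT2 (path_to h).
  have pqP := is_path_cat pP (is_path_map (deck g) qP).
  rewrite -deckM in pqP; rewrite (FE _ _ pqP) /F path_classM.
  congr loop_class; apply: val_inj; rewrite /= map_cat -map_comp; congr cat.
  by apply: eq_map => d; rewrite /map_dart /= deck_over_edge.
have Finj : injective F.
  move=> g h /path_classP H; apply: (@deck_free _ _ v).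
  have pP := lifts_path f (projT2 (path_to g)).
  have qP := lifts_path f (projT2 (path_to h)).
  move/(lifts_homotopic fcov _ H): pP => qP'.
  by rewrite (lifts_uniq fcov qP' qP).
have Fsurj y : exists g, F g = y.
  elim/pi1_ind: y => -[p pP]; have [w [p' p'P Ep] wv] := lifts_ex fcov pP.
  have [g Eg] := deck_trans (esym wv); rewrite Eg in p'P.
  by exists g; rewrite (FE _ _ p'P); congr loop_class; apply: val_inj.
pose mF := isMultiplicative.Build G (pi1 (f v)) F FM.
pose Fm : {multiplicative G -> pi1 (f v)} := HB.pack F mF.
by exists Fm; exact: inj_surj_bij Finj Fsurj.
Qed.

End DeckGroup.

(** * Equivariant maps and action complexes *)

Definition equivariant (S : semigroupType) (V W : Type) (a : paction S V)
    (b : paction S W) (h : V -> W) : Prop :=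
  forall v s, b (h v) s = omap h (a v s).

Section ActionPaths.
Variables (S : semigroupType) (X : choiceType) (gen : X -> S).
Variables (V : choiceType) (a : paction S V).

Local Notation is_path :=
  (edge_path (@edge_source S X gen V a) (@edge_target S X gen V a)).
Implicit Types (v w : V) (e : action_edge gen a).
Implicit Types (p q : seq (action_edge gen a * bool)).

Lemma edge_act e : a (edge_source e) (gen (edge_label e)) = Some (edge_target e).
Proof.
case: e => -[v x] /= H; rewrite /edge_source /edge_label /edge_target /=.
by case: (a v (gen x)) H.
Qed.

Lemma edge_inj e e' : edge_source e = edge_source e' ->
  edge_label e = edge_label e' -> e = e'.
Proof.
rewrite /edge_source /edge_label => E1 E2; apply: val_inj.
by case: (val e) (val e') E1 E2 => [? ?] [? ?] /= -> ->.
Qed.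

Lemma edge_ex v x w : a v (gen x) = Some w ->
  exists e, [/\ edge_source e = v, edge_label e = x & edge_target e = w].
Proof.
move=> H; have H' : isSome (a (v, x).1 (gen (v, x).2)) by rewrite /= H.
by exists (exist _ (v, x) H'); rewrite /edge_source /edge_label /edge_target /= H.
Qed.

Lemma directed_path_cons e s :
  directed_path gen a (edge_source e) (edge_label e :: s) =
  (e, true) :: directed_path gen a (edge_target e) s.
Proof.
rewrite /=; case: insubP => [e' _ Ee'|]; last by rewrite /= edge_act.
suff -> : e' = e by [].
by apply: edge_inj; rewrite /edge_source /edge_label Ee'.
Qed.

(** Since all directions are [true], this also expresses that [p] is directed. *)
Definition reads p (s : seq X) : Prop :=
  map (fun d => (edge_label d.1, d.2)) p = map (fun x => (x, true)) s.

Lemma reads_edge e : reads [:: (e, true)] [:: edge_label e].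
Proof. by []. Qed.

Lemma reads_cat p q s t : reads p s -> reads q t -> reads (p ++ q) (s ++ t).
Proof. by rewrite /reads !map_cat => -> ->. Qed.

Lemma reads_directed v p w s : is_path v p w -> reads p s ->
  p = directed_path gen a v s.
Proof.
elim: s p v => [|x s IH] [|[e b] p] v //=.
move=> /andP [/eqP ev pP] [ex eb ps]; rewrite eb /dart_src /dart_tgt /= in ev pP *.
rewrite -ex -ev -[RHS]/(directed_path gen a (edge_source e) (edge_label e :: s)).
by rewrite directed_path_cons -(IH _ _ pP ps).
Qed.

Lemma reads_act v p w (u : word X) : is_path v p w -> reads p (letters u) ->
  a v (eval gen u) = Some w.
Proof.
case: u => x s; rewrite /letters /=.
elim: s x p v => [|y s IH] x [|[e b] p] v //= /andP [/eqP ev pP] [ex eb ps].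
  case: p ps pP => // _ /eqP <-.
  by rewrite eb /dart_src /dart_tgt /= in ev *; rewrite -ev /eval /= -ex edge_act.
have -> : (x, y :: s) = word_mul (x, [::]) (y, s) by [].
rewrite eb /dart_src /dart_tgt /= in ev pP.
rewrite evalM actM {1}/eval /= -ex -ev edge_act.
exact: IH pP ps.
Qed.

Lemma directed_path_cat v m w (u u' : word X) :
  a v (eval gen u) = Some m -> a m (eval gen u') = Some w ->
  directed_path gen a v (letters (u * u')) =
  directed_path gen a v (letters u) ++ directed_path gen a m (letters u').
Proof.
move=> /directed_pathP [P1 E1] /directed_pathP [P2 E2].
apply/esym/(@reads_directed _ _ w); last exact: reads_cat E1 E2.
(* Paths are concatenated in the 1-skeleton: the action complex without relations. *)
exact: (is_path_cat (K := action_complex gen (fun _ _ => False) a) P1 P2).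
Qed.

End ActionPaths.

Lemma presents_rel (S : semigroupType) (X : choiceType) (gen : X -> S) R u v :
  presents gen R -> R u v -> eval gen u = eval gen v.
Proof. by case=> _ pres Ruv; apply/pres; exact: cong_base. Qed.

Section EquivariantMaps.
Variables (S : semigroupType) (X : choiceType) (gen : X -> S).
Variable R : word X -> word X -> Prop.
Variables (V W : choiceType) (a : paction S V) (b : paction S W) (h : V -> W).
Hypothesis hE : equivariant a b h.

Fact equivariant_edge_subproof (e : action_edge gen a) :
  isSome (b (h (edge_source e), edge_label e).1
            (gen (h (edge_source e), edge_label e).2)).
Proof. by rewrite /= hE edge_act. Qed.

Definition equivariant_edge (e : action_edge gen a) : action_edge gen b :=
  exist _ (h (edge_source e), edge_label e) (equivariant_edge_subproof e).

Lemma equivariant_target (e : action_edge gen a) :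
  edge_target (equivariant_edge e) = h (edge_target e).
Proof. by rewrite {1}/edge_target /= hE edge_act. Qed.

Lemma directed_path_map v s :
  map (map_dart equivariant_edge) (directed_path gen a v s) =
  directed_path gen b (h v) s.
Proof.
elim: s v => [|x s IH] v //.
case E: (a v (gen x)) => [w|]; last by rewrite /= !insubF //= ?hE E.
have [e [<- <- _]] := edge_ex E.
by rewrite directed_path_cons /= IH -equivariant_target -directed_path_cons.
Qed.

Lemma cell_boundary_map (c : action_cell gen R a) (c' : action_cell gen R b) :
    cell_source c' = h (cell_source c) -> cell_lhs c' = cell_lhs c ->
    cell_rhs c' = cell_rhs c ->
  cell_boundary c' = map (map_dart equivariant_edge) (cell_boundary c).
Proof.
rewrite /cell_boundary => -> -> ->; rewrite map_cat /path_inv map_rev -!map_comp.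
rewrite -!directed_path_map -!map_comp; congr (_ ++ rev _); exact: eq_map.
Qed.

Fact equivariant_cell_subproof (c : action_cell gen R a) :
  exists2 c' : action_cell gen R b, cell_source c' = h (cell_source c)
    & cell_boundary c' = map (map_dart equivariant_edge) (cell_boundary c).
Proof.
have act_h u : a (cell_source c) (eval gen u) = Some (cell_target c) ->
    b (h (cell_source c)) (eval gen u) = Some (h (cell_target c)).
  by move=> E; rewrite hE E.
exists (ActionCell (cell_rel c) (act_h _ (cell_lhsP c)) (act_h _ (cell_rhsP c))) => //.
exact: cell_boundary_map.
Qed.

Definition equivariant_map :
    complex_map (action_complex gen R a) (action_complex gen R b) :=
  @ComplexMap (action_complex gen R a) (action_complex gen R b) h equivariant_edge
    (fun=> erefl) equivariant_target equivariant_cell_subproof.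

(** Darts leaving [v] forwards lift uniquely along any equivariant map, because an
    edge is determined by its source and its label; the two conditions are
    exactly the unique lifting of edges arriving at [v]. For 2-cells, the path
    labelled by one side of a relation ends where the other does because the two
    words are equal in [S]: this is where the relations must hold in [S]. *)
Lemma equivariant_covering : presents gen R ->
    (forall o x v, b o (gen x) = Some (h v) ->
       exists2 u, h u = o & a u (gen x) = Some v) ->
    (forall u u' x v, h u = h u' -> a u (gen x) = Some v -> a u' (gen x) = Some v ->
       u = u') ->
  covering equivariant_map.
Proof.
move=> pres lift_in uniq_in; split=> [v [e []]|v c] /=.
- rewrite /dart_src /= => ev; have := edge_act e; rewrite ev hE.
  case E: (a v _) => [w|//] _; have [e' [e'v e'x _]] := edge_ex E.
  exists (e', true); split; first split=> //.
    congr pair; apply: edge_inj => //=.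
    by rewrite ev {1}/edge_source /= e'v.
  move=> [e1 b1] [] + [ee Eb]; rewrite Eb /dart_src /= => e1v.
  congr pair; apply: edge_inj; first by rewrite e'v e1v.
  by rewrite e'x -ee.
- rewrite /dart_src /= => ev; have := edge_act e; rewrite ev => /lift_in [u uo uv].
  have [e' [e'u e'x e'v]] := edge_ex uv.
  exists (e', false); split; first split=> //.
    congr pair; apply: edge_inj => //=.
    by rewrite {1}/edge_source /= e'u.
  move=> [e1 b1] [] + [ee Eb]; rewrite Eb /dart_src /= => e1v.
  have e1x : edge_label e1 = edge_label e by rewrite -ee.
  congr pair; apply: edge_inj; last by rewrite e'x e1x.
  rewrite e'u; apply: (uniq_in _ _ (edge_label e) v) => //.
    by rewrite uo -ee.
  by rewrite -e1x edge_act; congr Some.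
- move=> cv; have := cell_lhsP c; rewrite [cell_source c]cv hE.
  case lhsP: (a v _) => [w|//] _; have rhsP := lhsP.
  rewrite (presents_rel pres (cell_rel c)) in rhsP.
  exists (ActionCell (cell_rel c) lhsP rhsP) => //.
  exact/esym/cell_boundary_map.
Qed.

End EquivariantMaps.

(** * Simple connectivity of the action complex *)

Section SimplyConnected.
Variables (S : semigroupType) (X : choiceType) (gen : X -> S).
Variable R : word X -> word X -> Prop.
Variables (V : choiceType) (a : paction S V).
Hypothesis pres : presents gen R.

Local Notation K := (action_complex gen R a).
Implicit Types (v w : V) (p q : seq (action_edge gen a * bool)).
Implicit Types (u : word X) (s t : S).

Local Notation is_path := (is_path (K := K)).
Local Notation homotopic := (homotopic (K := K)).
Local Notation path_of v u := (directed_path gen a v (letters u)).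

Lemma path_ofP v u w : a v (eval gen u) = Some w -> is_path v (path_of v u) w.
Proof. by case/directed_pathP. Qed.

(** The 2-cells realize the defining relations, and homotopy is stable under
    concatenation on both sides, as the congruence on words is. The end point [w]
    varies in the induction, so that intermediate words and factors, which act
    in the same way as they are equal in [S], can be given theirs. *)
Lemma path_of_homotopic u u' v w :
  eval gen u = eval gen u' -> a v (eval gen u) = Some w ->
  homotopic v w (path_of v u) (path_of v u').
Proof.
move=> /pres.2 uu'.
elim: uu' v w => {u u'} [u u' Ruu'|u|u u' uu' IH|u1 u2 u3 u12 IH12 _ IH23
  |t u u' uu' IH|t u u' uu' IH] v w vu.
- have vu' := vu; rewrite (presents_rel pres Ruu') in vu'.
  have uP := path_ofP vu; have u'P := path_ofP vu'.
  apply: (homotopic_cancelr (is_path_inv u'P) uP u'P).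
  apply: homotopic_trans _ (homotopic_sym (homotopic_invr u'P)).
  pose c : cell K := ActionCell Ruu' vu vu'.
  have := @homotopic_cell K v v [::] [::] c; rewrite /= cats0; apply.
  exact: (boundaryP c).
- exact: homotopic_refl (path_ofP vu).
- by apply/homotopic_sym/IH; rewrite (proj2 (pres.2 u u') uu').
- apply: homotopic_trans (IH12 _ _ vu) _.
  by apply: IH23; rewrite -(proj2 (pres.2 _ _) u12).
- move: vu; rewrite evalM actM; case vt: (a v _) => [m|] mu; last by [].
  rewrite [LHS]/= in mu; have mu' := mu; rewrite (proj2 (pres.2 _ _) uu') in mu'.
  rewrite (directed_path_cat vt mu) (directed_path_cat vt mu').
  exact: (homotopic_cat (homotopic_refl (path_ofP vt)) (IH _ _ mu)).
- move: vu; rewrite evalM actM; case vu: (a v _) => [m|] mt; last by [].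
  rewrite [LHS]/= in mt; have vu' := vu; rewrite (proj2 (pres.2 _ _) uu') in vu'.
  rewrite (directed_path_cat vu mt) (directed_path_cat vu' mt).
  exact: (homotopic_cat (IH _ _ vu) (homotopic_refl (path_ofP mt))).
Qed.

Section BasePoint.
Variable v0 : V.
Hypothesis trans_a : transitive_action a.
Hypothesis stab0 : forall (H : groupType) (f : {multiplicative stabilizer a v0 -> H})
  (s t : stabilizer a v0), f s = f t.

(** The only use of the stabilizer condition, applied to the fundamental group at
    [v0] itself. *)
Lemma directed_loop_null u : a v0 (eval gen u) = Some v0 ->
  homotopic v0 v0 (path_of v0 u) [::].
Proof.
move=> loop_u; pose word_of s := projT1 (cid (pres.1 s)).
have word_ofE s : eval gen (word_of s) = s by rewrite /word_of; case: cid.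
have act_word (s : stabilizer a v0) : a v0 (eval gen (word_of (val s))) = Some v0.
  by rewrite word_ofE; apply/eqP; exact: (valP s).
pose f (s : stabilizer a v0) : pi1 (K := K) v0 := path_class (path_ofP (act_word s)).
have fM : {morph f : s t / s * t}.
  move=> s t; rewrite path_classM; apply/path_classP.
  rewrite -(directed_path_cat (act_word s) (act_word t)).
  apply: path_of_homotopic (act_word _).
  by rewrite evalM !word_ofE.
pose mf := isMultiplicative.Build (stabilizer a v0) (pi1 (K := K) v0) f fM.
pose F : {multiplicative stabilizer a v0 -> pi1 (K := K) v0} := HB.pack f mf.
pose s : stabilizer a v0 := exist _ (eval gen u) (introT eqP loop_u).
(* [f] takes the same value at [s] and at [s * s], so [f s] is idempotent. *)
have fs1 : f s = 1.
  by apply: (mulgI (f s)); rewrite mulg1 -fM; exact: (stab0 F).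
apply: homotopic_trans (path_of_homotopic _ loop_u) _; last first.
  exact: (proj1 (loop_classP _ (loop_one _)) fs1).
by rewrite word_ofE.
Qed.

Lemma reads_ex v w : exists2 p, is_path v p w & exists l, reads p l.
Proof.
case: (trans_a v w) => [->|[s vs]].
  by exists [::]; [exact: is_path_nil | exists [::]].
have [u us] := pres.1 s; rewrite -us in vs.
exists (path_of v u); first exact: path_ofP.
by exists (letters u); case: (directed_pathP vs).
Qed.

Lemma reads_loop_null p l : is_path v0 p v0 -> reads p l -> homotopic v0 v0 p [::].
Proof.
case: l => [|x l] pP pl.
  by case: p pl pP => // _ pP; exact: homotopic_refl.
rewrite (reads_directed pP pl); apply: (@directed_loop_null (x, l)).
exact: (reads_act (u := (x, l)) pP pl).
Qed.

(** A directed path [r] back to [v0] turns both paths into directed loops at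
    [v0], which are null-homotopic, and can be cancelled afterwards. *)
Lemma reads_homotopic v p q l k : is_path v0 p v -> is_path v0 q v ->
  reads p l -> reads q k -> homotopic v0 v p q.
Proof.
move=> pP qP pl qk; have [r rP [m rm]] := reads_ex v v0.
apply: (homotopic_cancelr rP pP qP).
have null z n : is_path v0 z v -> reads z n -> homotopic v0 v0 (z ++ r) [::].
  by move=> zP zn; apply: reads_loop_null (is_path_cat zP rP) (reads_cat zn rm).
exact: homotopic_trans (null _ _ pP pl) (homotopic_sym (null _ _ qP qk)).
Qed.

(** Directed paths from [v0] play the role of a maximal tree: appending any edge,
    in either direction, to the chosen path to one of its ends gives the
    chosen path to the other end. A forward edge extends a directed path; for
    a backward edge the same fact is applied to its inverse. *)
Lemma absorb_path p v w q r k l : is_path v p w ->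
  is_path v0 q v -> reads q k -> is_path v0 r w -> reads r l ->
  homotopic v0 w (q ++ p) r.
Proof.
elim: p v q k => [|d p IH] v q k.
  rewrite cats0 => /eqP <- qP qk rP rl; exact: reads_homotopic qP rP qk rl.
rewrite is_path_cons => /andP [/eqP dv pP] qP qk rP rl.
set z := dart_tgt (@source K) (@target K) d in pP.
have dP : is_path v [:: d] z.
  by rewrite -dv; exact: is_path_dart.
have [t tP [m tm]] := reads_ex v0 z.
suff qd : homotopic v0 z (q ++ [:: d]) t.
  rewrite -cat1s catA.
  apply: homotopic_trans (IH _ _ _ pP tP tm rP rl).
  exact: (homotopic_cat qd (homotopic_refl pP)).
case: d @z dv pP dP tP tm => e [] z dv pP dP tP tm.
  exact: reads_homotopic (is_path_cat qP dP) tP (reads_cat qk (reads_edge e)) tm.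
have d'P := is_path_inv dP.
have te : homotopic v0 v (t ++ path_inv [:: (e, false)]) q.
  exact: reads_homotopic (is_path_cat tP d'P) qP (reads_cat tm (reads_edge e)) qk.
apply: homotopic_trans (homotopic_cat (homotopic_sym te) (homotopic_refl dP)) _.
rewrite -catA -{2}[t]cats0.
exact: homotopic_cat (homotopic_refl tP) (homotopic_invl dP).
Qed.

End BasePoint.

Theorem action_complex_simply_connected : inhabited V ->
  transitive_action a -> stabilizer_condition a -> simply_connected K.
Proof.
move=> inhV trans_a [v0 stab0]; split.
  by split=> // v w; have [p pP _] := reads_ex trans_a v w; exists p.
move=> b; elim/pi1_ind=> -[p pP]; apply/loop_classP => /=.
have [q qP [l ql]] := reads_ex trans_a v0 b.
apply: (homotopic_cancell qP pP (is_path_nil _)); rewrite cats0.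
exact: (absorb_path trans_a stab0 pP qP ql qP ql).
Qed.

End SimplyConnected.

(** * The covering by the orbit projection *)

Section Orbits.
Variables (S : semigroupType) (V : choiceType) (a : paction S V).
Hypothesis trans_a : transitive_action a.

(** Every point is [v] or some [vs], and automorphisms commute with [s]. *)
Lemma aut_free (g h : Aut a) v : g v = h v -> g = h.
Proof.
move=> gh; apply: aut_eqP => w.
case: (trans_a v w) => [->//|[s vs]]; apply: Some_inj.
rewrite -[Some (g w)]/(omap g (Some w)) -[Some (h w)]/(omap h (Some w)) -vs.
by rewrite -!aut_act gh.
Qed.

Variable G : groupClosed (Aut a).

Lemma orbit_ofP v w :
  orbit_of G v = orbit_of G w <-> exists2 g : Aut a, g \in (G : {pred Aut a}) & w = g v.
Proof.
split=> [/eqmodP /= /asboolP //|H].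
by apply/eqmodP => /=; apply/asboolP.
Qed.

Lemma orbit_of_equivariant : equivariant a (orbit_action G) (orbit_of G).
Proof. exact: orbit_act_funE. Qed.

(** If an edge arrives at the orbit of [v], translating it by an element of [G]
    makes it arrive at [v]; if two edges of the same orbit arrive at [v], the
    element relating them fixes [v], so it is [1]. *)
Lemma orbit_covering (X : choiceType) (gen : X -> S) R :
  presents gen R -> covering (equivariant_map gen R orbit_of_equivariant).
Proof.
move=> pres; apply: equivariant_covering pres _ _ => [o x v|u u' x v].
  rewrite -[o]reprK -/(orbit_of G (repr o)) [LHS]orbit_act_funE.
  case E: (a _ _) => [w|//] /= [/orbit_ofP [g Gg ->]].
  exists (g (repr o)); last by rewrite aut_act E.
  by apply/esym/orbit_ofP; exists g.
move=> /orbit_ofP [g Gg ->] uv; rewrite aut_act uv => -[gv].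
by rewrite (@aut_free g 1 v).
Qed.

End Orbits.

Theorem theorem2p8 (S : semigroupType) (X : choiceType) (gen : X -> S)
    (R : word X -> word X -> Prop) (V : choiceType) (a : paction S V) :
  presents gen R ->
  inhabited V ->
  transitive_action a ->
  stabilizer_condition a ->
  simply_connected (action_complex gen R a) /\
  (forall (G : groupClosed (Aut a))
          (b : vertex (action_complex gen R (orbit_action G))),
     isomorphic (subgroup_of G)
                (pi1 (K := action_complex gen R (orbit_action G)) b)).
Proof.
move=> pres inhV trans_a stab_a.
have Ksc := action_complex_simply_connected pres inhV trans_a stab_a.
split=> // G b; rewrite -[b]reprK.
have deckE (g : subgroup_of G) : equivariant a a (val g) by exact: aut_act.
pose f := equivariant_map gen R (orbit_of_equivariant G).
pose deck (g : subgroup_of G) := equivariant_map gen R (deckE g).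
have deck_over g v : orbit_of G (deck g v) = orbit_of G v.
  by apply/esym/orbit_ofP; exists (val g) => //; exact: (valP g).
apply: (@deck_group_pi1 _ _ f _ deck Ksc) => //.
- exact: orbit_covering.
- by move=> g e; apply: edge_inj => //; exact: deck_over.
- by move=> v w /orbit_ofP [g Gg ->]; exists (exist _ g Gg).
- by move=> g h v gh; apply: val_inj; exact: (aut_free trans_a gh).
Qed.
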